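(* Let $F$ be any one of the following Banach spaces of functions on a set $T$: $\ell^\infty(\mathbb N)$ (with $T=\mathbb N$); $\mathrm{BV}_p$ for some $p>1$ (with $T=[0,1]$); $C^{0,\alpha}([0,1])$ for some $\alpha\in(0,1]$ (with $T=[0,1]$). Then the It\^o--Nisio theorem is not valid for $F$; that is, it is not true that for every sequence $\{X_j\}$ of independent and symmetric stochastic processes indexed by $T$ with paths in $F$, with $S_n=\sum_{j=1}^nX_j$, the following two conditions are equivalent: (i) $S_n$ converges in finite dimensional distributions to a process with paths in $F$; (ii) $S_n$ converges a.s. in $(F,\|\cdot\|_F)$.
   Context: $\ell^\infty(\mathbb N)$ is the space of bounded real sequences $\{a_k\}_{k\in\mathbb N}$ with norm $\sup_k|a_k|$. For $p\ge1$, $\mathrm{BV}_p$ is the space of right-continuous functions $f:[0,1]\to\mathbb R$ of bounded $p$-variation with $f(0)=0$, equipped with the norm $$\|f\|_{\mathrm{BV}_p}=\sup\Bigl\{\Bigl(\sum_{j=1}^n|f(t_j)-f(t_{j-1})|^p\Bigr)^{1/p}:n\in\mathbb N,\ 0=t_0\le\cdots\le t_n=1\Bigr\}.$$ For $\alpha\in(0,1]$, $C^{0,\alpha}([0,1])$ is the space of $\alpha$-H\''older continuous functions $f:[0,1]\to\mathbb R$ with $f(0)=0$, equipped with the norm $\|f\|_{C^{0,\alpha}}=\sup_{s\ne t}|f(t)-f(s)|/|t-s|^\alpha$. A process with paths in $F$ is regarded as a random vector in $F$ measurable for the cylindrical $\sigma$-algebra $\sigma(\delta_t:t\in T)$, where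 $\delta_t(x)=x(t)$. *)

(* Defs.v *)
From HB Require Import structures.
From mathcomp Require Import all_boot all_order all_algebra finmap.
From mathcomp Require Import all_classical all_reals all_analysis.

Set Implicit Arguments.
Unset Strict Implicit.
Unset Printing Implicit Defensive.

Import Order.TTheory GRing.Theory Num.Theory.
Import numFieldNormedType.Exports.

Local Open Scope classical_set_scope.
Local Open Scope ring_scope.

(* A normed space of functions on T. The norm is a supremum taken in \bar R, so
   it makes sense on all functions; it is finite on the carrier for the spaces
   below. *)
Record function_space (R : realType) (T : Type) := FunctionSpace {
  carrier : set (T -> R) ;
  fnorm : (T -> R) -> \bar R }.

Definition linfty (R : realType) : function_space R nat :=
  FunctionSpace
    [set a : nat -> R | bounded_fun a]
    (fun a => ereal_sup (range (fun k => `|a k|%:E))).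

Definition unit_interval (R : realType) : Type := `[0 : R, 1]%classic.

Lemma unit_interval0_subproof (R : realType) : (0 : R) \in `[0 : R, 1]%classic.
Proof. by rewrite mem_setE in_itv/= lexx ler01. Qed.

Lemma unit_interval1_subproof (R : realType) : (1 : R) \in `[0 : R, 1]%classic.
Proof. by rewrite mem_setE in_itv/= lexx ler01. Qed.

Definition I0 (R : realType) : unit_interval R :=
  exist _ 0 (unit_interval0_subproof R).

Definition I1 (R : realType) : unit_interval R :=
  exist _ 1 (unit_interval1_subproof R).

(* At t = 1 the filter is improper and the condition is void. *)
Definition right_continuous01 (R : realType) (f : unit_interval R -> R) :=
  forall t : `[0 : R, 1]%classic,
    f s @[s --> within (fun s => \val t < \val s) (nbhs t)] --> f t.

Definition subdivision (R : realType) (n : nat) (t : nat -> unit_interval R) :=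
  [/\ t 0%N = I0 R, t n = I1 R &
      forall j, (j < n)%N -> \val (t j) <= \val (t j.+1)].

Definition pvariation (R : realType) (p : R) (f : unit_interval R -> R) : \bar R :=
  ereal_sup [set v : \bar R |
    exists (n : nat) (t : nat -> unit_interval R), subdivision n t /\
      v = ((\sum_(j < n) `|f (t j.+1) - f (t j)| `^ p) `^ p^-1)%:E].

Definition BV (R : realType) (p : R) : function_space R (unit_interval R) :=
  FunctionSpace
    [set f : unit_interval R -> R |
      [/\ right_continuous01 f, (pvariation p f < +oo)%E & f (I0 R) = 0]]
    (pvariation p).

Definition hoelder_continuous (R : realType) (alpha : R)
    (f : unit_interval R -> R) :=
  exists C : R, forall s t : unit_interval R,
    `|f t - f s| <= C * `|\val t - \val s| `^ alpha.

Definition C0 (R : realType) (alpha : R) : function_space R (unit_interval R) :=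
  FunctionSpace
    [set f : unit_interval R -> R | hoelder_continuous alpha f /\ f (I0 R) = 0]
    (fun f => ereal_sup [set v : \bar R |
      exists s t : unit_interval R, s <> t /\
        v = (`|f t - f s| / `|\val t - \val s| `^ alpha)%:E]).

Definition coordinate_cylinders (R : realType) (T : Type) : set (set (T -> R)) :=
  \bigcup_(t in [set: T])
    preimage_set_system setT (fun x : T -> R => x t) measurable.

(* T -> R with the cylindrical sigma-algebra. A map into a set F of paths is
   measurable for the trace of this sigma-algebra on F iff it is measurable as a
   map into paths R T, and both generate the same sigma-algebra on the domain. *)
Definition paths (R : realType) (T : Type) : measurableType _ :=
  g_sigma_algebraType (@coordinate_cylinders R T).

Section processes.
Context (R : realType) (T : Type) (d : measure_display) (Omega : measurableType d)
  (P : probability Omega R).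

Definition process_in (F : function_space R T) (X : Omega -> T -> R) :=
  (forall w, carrier F (X w)) /\ measurable_fun [set: Omega] (X : Omega -> paths R T).

Definition symmetric_process (X : Omega -> T -> R) :=
  forall B : set (paths R T), measurable B ->
    P (X @^-1` B) = P ((fun w => - X w) @^-1` B).

Definition independent_processes (X : nat -> Omega -> T -> R) :=
  forall (J : {fset nat}) (B : nat -> set (paths R T)),
    (forall j, j \in J -> measurable (B j)) ->
    P (\bigcap_(j in [set` J]) X j @^-1` B j)
      = (\prod_(j <- J) P (X j @^-1` B j))%E.

Definition partial_sum (X : nat -> Omega -> T -> R) (n : nat) : Omega -> T -> R :=
  fun w => \sum_(j < n) X j w.

Definition cvg_as (F : function_space R T) (S : nat -> Omega -> T -> R) :=
  {ae P, forall w, exists2 f : T -> R, carrier F f &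
    fnorm F (S n w - f) @[n --> \oo] --> 0%E}.

End processes.

(* The limit Y may live on another probability space. *)
Definition cvg_fdd (R : realType) (T : Type)
    (d : measure_display) (Omega : measurableType d) (P : probability Omega R)
    (d' : measure_display) (Omega' : measurableType d') (Q : probability Omega' R)
    (S : nat -> Omega -> T -> R) (Y : Omega' -> T -> R) :=
  forall (k : nat) (t : 'I_k -> T) (g : 'rV[R]_k -> R),
    continuous g -> bounded_fun g ->
    ('E_P[fun w => g (\row_i S n w (t i))] @[n --> \oo]
       --> 'E_Q[fun w => g (\row_i Y w (t i))])%E.

Definition ito_nisio_valid (R : realType) (T : Type) (F : function_space R T) :=
  forall (d : measure_display) (Omega : measurableType d)
    (P : probability Omega R) (X : nat -> Omega -> T -> R),
    (forall j, process_in F (X j)) ->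
    independent_processes P X ->
    (forall j, symmetric_process P (X j)) ->
    (exists (d' : measure_display) (Omega' : measurableType d')
        (Q : probability Omega' R) (Y : Omega' -> T -> R),
      process_in F Y /\ cvg_fdd P Q (partial_sum X) Y)
    <-> cvg_as P F (partial_sum X).

(* Main.v *)
Require Import Defs.
From mathcomp Require Import all_boot all_order all_algebra finmap.
From mathcomp Require Import all_classical all_reals all_analysis.
From mathcomp Require Import measurable_realfun.
From mathcomp Require Import ring lra.

(** In each space take [X_j = eps_j x_j] with [eps_j] independent signs (the
    binary digits of a uniform variable) and functions [x_j] whose norms are
    bounded below, yet such that every signed sum [\sum_j e_j x_j] converges
    pointwise to an element of the space. Then [S_n] converges pointwise for
    every outcome, hence in finite dimensional distributions, while its
    increments do not tend to 0 in norm.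
    - [linfty]: the unit vectors;
    - [C0 alpha]: the [alpha]-th powers of tents with disjoint supports;
    - [BV p]: [x_j(t) = 2^(-j/p) dist(2^j t, Z)]; signed sums are [1/p]-Hoelder,
      and on the grid of mesh [2^-(j+1)] all [2^(j+1)] increments of [x_j] have
      modulus [2^(-j/p) / 2]. *)

Set Implicit Arguments.
Unset Strict Implicit.
Unset Printing Implicit Defensive.

Import Order.TTheory GRing.Theory Num.Theory.
Import numFieldNormedType.Exports.

Local Open Scope classical_set_scope.
Local Open Scope ring_scope.

(** * Independent signs *)

Section rademacher.
Context (R : realType).

Definition dyadic_itv (m k : nat) : set R :=
  `[k%:R / 2 ^+ m, k.+1%:R / 2 ^+ m[%classic.

(** The digit of weight [2^-(m+1)]. Membership in a countable union of intervals makes its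
    measurability immediate. *)
Definition binary_digit (m : nat) (w : R) : bool :=
  w \in \bigcup_k dyadic_itv m.+1 k.*2.+1.

Definition unif01 : probability (measurableTypeR R) R :=
  uniform_prob (@ltr01 R).

Lemma binary_digit_dyadic (m k : nat) (w : R) :
  dyadic_itv m.+1 k w -> binary_digit m w = odd k.
Proof.
have H0 : (0 : R) < 2 ^+ m.+1 by rewrite exprn_gt0.
rewrite /dyadic_itv /= in_itv /= ler_pdivrMr// ltr_pdivlMr// => /andP[kw wk].
apply/idP/idP.
  rewrite /binary_digit inE => -[j _].
  rewrite /dyadic_itv /= in_itv /= ler_pdivrMr// ltr_pdivlMr// => /andP[jw wj].
  have kj : (k < j.*2.+2)%N by rewrite -(ltr_nat R); exact: le_lt_trans kw wj.
  have jk : (j.*2.+1 < k.+1)%N by rewrite -(ltr_nat R); exact: le_lt_trans jw wk.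
  have -> : k = j.*2.+1 by apply/eqP; rewrite eqn_leq -ltnS kj -ltnS jk.
  by rewrite /= odd_double.
move=> ok; rewrite /binary_digit inE; exists k./2 => //.
have -> : (k./2.*2.+1 = k)%N by rewrite -[RHS]odd_double_half ok.
by rewrite /dyadic_itv /= in_itv /= ler_pdivrMr// ltr_pdivlMr// kw wk.
Qed.

Lemma measurable_dyadic_itv m k :
  measurable (dyadic_itv m k : set (measurableTypeR R)).
Proof. exact: measurable_itv. Qed.

Lemma measurable_binary_digit m :
  measurable_fun [set: measurableTypeR R] (binary_digit m).
Proof.
apply: (@measurable_fun_bool _ _ _ _ true).
rewrite setTI.
have -> : binary_digit m @^-1` [set true] = \bigcup_k dyadic_itv m.+1 k.*2.+1.
  by apply/seteqP; split => w /=; [exact: set_mem | exact: mem_set].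
by apply: bigcup_measurable => k _; exact: measurable_dyadic_itv.
Qed.

Lemma dyadic_itv_split m k :
  dyadic_itv m k = dyadic_itv m.+1 k.*2 `|` dyadic_itv m.+1 k.*2.+1.
Proof.
have H0 : (0 : R) < 2 ^+ m by rewrite exprn_gt0.
have E j : (j.*2%:R / 2 ^+ m.+1 : R) = j%:R / 2 ^+ m.
  by rewrite exprS -mul2n natrM -mulf_div divff ?mul1r// pnatr_eq0.
rewrite /dyadic_itv -!doubleS !E.
apply/seteqP; split=> w /=; rewrite !in_itv /=.
  move=> /andP[-> ->]; rewrite andbT.
  by case: (ltP w (k.*2.+1%:R / 2 ^+ m.+1)); [left|right].
have l1 : (k.*2%:R / 2 ^+ m.+1 : R) <= k.*2.+1%:R / 2 ^+ m.+1.
  by rewrite ler_pM2r ?invr_gt0 ?exprn_gt0// ler_nat.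
have l2 : (k.*2.+1%:R / 2 ^+ m.+1 : R) <= k.+1.*2%:R / 2 ^+ m.+1.
  by rewrite ler_pM2r ?invr_gt0 ?exprn_gt0// ler_nat doubleS.
rewrite !E in l1 l2.
case=> /andP[a b]; apply/andP; split=> //.
- exact: lt_le_trans b l2.
- exact: le_trans l1 a.
Qed.

Lemma unif01_dyadic_itv m k : (k < 2 ^ m)%N ->
  unif01 (dyadic_itv m k) = (2 ^- m)%:E.
Proof.
move=> km; have H0 : (0 : R) < 2 ^+ m by rewrite exprn_gt0.
rewrite /unif01 /= /uniform_prob integral_uniform_pdf.
have -> : dyadic_itv m k `&` `[0, 1]%classic = dyadic_itv m k.
  apply/setIidPl => w; rewrite /dyadic_itv /= !in_itv /= => /andP[a b].
  apply/andP; split.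
    by apply: le_trans a; rewrite divr_ge0// ltW.
  apply: le_trans (ltW b) _; rewrite ler_pdivrMr// mul1r.
  by rewrite -natrX ler_nat.
rewrite (eq_integral (cst 1%:E)); last first.
  move=> w; rewrite inE /dyadic_itv /= in_itv /= => /andP[a b].
  rewrite /uniform_pdf subr0 invr1 ifT//.
  apply/andP; split.
    by apply: le_trans a; rewrite divr_ge0// ltW.
  apply: le_trans (ltW b) _; rewrite ler_pdivrMr// mul1r.
  by rewrite -natrX ler_nat.
rewrite integral_cst ?mul1e; last exact: measurable_dyadic_itv.
rewrite /= /dyadic_itv lebesgue_measure_itv /= lte_fin ltr_pM2r ?invr_gt0//.
rewrite ltr_nat ltnSn -EFinB; congr (_%:E).
by rewrite -mulrBl -natrB// subSnn mul1r.
Qed.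

(** Each factor is the probability that a fair bit satisfies [A j]. Restricting to an arbitrary
    dyadic interval of level [m] is what lets the induction run: its two halves are dyadic of level
    [m+1], and digit [m] is constant on each. *)
Lemma unif01_dyadic_itv_digits (A : nat -> pred bool) n m k : (k < 2 ^ m)%N ->
  unif01 (dyadic_itv m k `&`
    [set w | forall j, (m <= j < m + n)%N -> A j (binary_digit j w)]) =
  (2 ^- m * \prod_(m <= j < m + n) ((A j false + A j true)%:R / 2))%:E.
Proof.
have mA a b : measurable ([set w | forall j, (a <= j < b)%N ->
    A j (binary_digit j w)] : set (measurableTypeR R)).
  have -> : [set w | forall j, (a <= j < b)%N -> A j (binary_digit j w)] =
    \bigcap_(j in [set j | (a <= j < b)%N]) (binary_digit j @^-1` A j).
    by apply/seteqP; split.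
  apply: bigcap_measurableType => j _; rewrite -[X in measurable X]setTI.
  exact: measurable_binary_digit.
elim: n m k => [|n IH] m k km.
  rewrite addn0 big_geq// mulr1 -(unif01_dyadic_itv km); congr (unif01 _).
  apply/seteqP; split=> w /=; first by case.
  by move=> h; split=> // j /andP[a b]; move: (leq_ltn_trans a b); rewrite ltnn.
rewrite dyadic_itv_split setIUl measureU; first last.
- rewrite -subset0 => w /= [[a _] [b _]].
  by move: (binary_digit_dyadic a); rewrite (binary_digit_dyadic b) /= odd_double.
- by apply: measurableI => //; exact: measurable_dyadic_itv.
- by apply: measurableI => //; exact: measurable_dyadic_itv.
(* On a half where digit [m] equals [b], the constraint [A m] either holds throughout or empties the
   set. *)
have H b j : odd j = b -> (j < 2 ^ m.+1)%N ->
  unif01 (dyadic_itv m.+1 j `&`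
    [set w | forall j, (m <= j < m + n.+1)%N -> A j (binary_digit j w)]) =
  ((A m b)%:R * (2 ^- m.+1 *
     \prod_(m.+1 <= j < m + n.+1) ((A j false + A j true)%:R / 2)))%:E.
  move=> ob jm; rewrite addnS -addSn.
  case: (boolP (A m b)) => Amb; last first.
    rewrite mul0r -[RHS](measure0 unif01); congr (unif01 _).
    rewrite -subset0 => w /= [/binary_digit_dyadic + h].
    by move=> E; move: (h m); rewrite E ob (negbTE Amb) leqnn ltnS leq_addr => /(_ isT).
  rewrite mul1r -(IH _ j)//; congr (unif01 _); apply/seteqP; split=> w /= [i h]; split=> //.
    by move=> l /andP[a c]; apply: h; rewrite c (ltnW a).
  move=> l /andP[a c]; move: a; rewrite leq_eqVlt => /predU1P[<-|a].
    by rewrite (binary_digit_dyadic i) ob.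
  by apply: h; rewrite a c.
pose Q : R := 2 ^- m.+1 *
  \prod_(m.+1 <= j < m + n.+1) ((A j false + A j true)%:R / 2).
transitivity (((A m false)%:R * Q)%:E + ((A m true)%:R * Q)%:E)%E.
  congr (_ + _)%E; apply: H; rewrite /= ?odd_double//.
    by rewrite expnS mul2n ltn_double.
  by rewrite expnS mul2n -doubleS leq_double.
rewrite /Q [in RHS]big_ltn; last by rewrite addnS ltnS leq_addr.
rewrite -EFinD; congr (_%:E); rewrite -mulrDl exprS invfM natrD.
by ring.
Qed.

Lemma unif01_digits (A : nat -> pred bool) (J : {fset nat}) :
  unif01 (\bigcap_(j in [set` J]) (binary_digit j @^-1` A j)) =
  (\prod_(j <- J) ((A j false + A j true)%:R / 2)%:E)%E.
Proof.
pose n := (\max_(j <- J) j).+1.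
have Jn j : j \in J -> (j < n)%N.
  by move=> jJ; rewrite ltnS; exact: (@leq_bigmax_seq _ (enum_fset J) xpredT id j jJ isT).
(* Indices outside [J] get the trivial constraint, whose factor is [(1 + 1) / 2 = 1], so an initial
   segment of digits can be used. *)
pose A' j : pred bool := fun b => (j \in J) ==> A j b.
have mB : measurable (\bigcap_(j in [set` J]) (binary_digit j @^-1` A j)
    : set (measurableTypeR R)).
  apply: bigcap_measurableType => j _; rewrite -[X in measurable X]setTI.
  exact: measurable_binary_digit.
(* [dyadic_itv 0 0] is [[0, 1[], so intersecting with it changes no probability. *)
have P1 : unif01 (~` dyadic_itv 0 0) = 0%E.
  rewrite probability_setC; last exact: measurable_dyadic_itv.
  by rewrite unif01_dyadic_itv// expr0 invr1 subee.
have P2 : unif01 (\bigcap_(j in [set` J]) (binary_digit j @^-1` A j)) =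
  unif01 (dyadic_itv 0 0 `&` \bigcap_(j in [set` J]) (binary_digit j @^-1` A j)).
  rewrite (measureDI unif01 mB (measurable_dyadic_itv 0 0)).
  rewrite [X in (X + _)%E](_ : _ = 0%E) ?add0e 1?setIC//.
  apply: (subset_measure0 _ _ _ P1).
  - by apply: measurableD => //; exact: measurable_dyadic_itv.
  - by apply: measurableC; exact: measurable_dyadic_itv.
  - by move=> w [].
have := @unif01_dyadic_itv_digits A' n 0 0 isT.
rewrite expr0 invr1 mul1r add0n P2.
rewrite (_ : [set w | _] = \bigcap_(j in [set` J]) (binary_digit j @^-1` A j)).
  move=> ->; rewrite prodEFin; congr (_%:E).
  rewrite (bigID (mem J)) /= [X in _ * X]big1 ?mulr1; last first.
    by move=> j jJ; rewrite /A' (negbTE jJ) /= divff.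
  rewrite -big_filter; under [RHS]eq_big_seq => j jJ.
    rewrite (_ : A j false = A' j false); last by rewrite /A' jJ.
    rewrite (_ : A j true = A' j true); last by rewrite /A' jJ.
    over.
  apply: perm_big; apply: uniq_perm.
  - by rewrite filter_uniq// iota_uniq.
  - exact: fset_uniq.
  - by move=> j; rewrite mem_filter mem_index_iota andb_idr// => /Jn.
apply/seteqP; split=> w /= h j.
  by move=> jJ; move: (h j (Jn _ jJ)); rewrite /A' jJ.
by move=> _; rewrite /A'; apply/implyP => jJ; exact: h.
Qed.

End rademacher.

(** * Series with Rademacher coefficients *)

Section rademacher_series.
Context (R : realType) (T : Type) (F : function_space R T) (x : nat -> T -> R).

Definition rademacher_term (j : nat) (w : measurableTypeR R) : T -> R :=
  fun t => (-1) ^+ binary_digit j w * x j t.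

(** The term factors through the digit, a measurable map into the discrete space [bool]. *)
Lemma measurable_rademacher_term j :
  measurable_fun setT (rademacher_term j : measurableTypeR R -> paths R T).
Proof.
move=> _ B _.
rewrite (_ : setT `&` rademacher_term j @^-1` B = setT `&` binary_digit j @^-1`
  [set b : bool | B (fun t => (-1) ^+ b * x j t)])//.
exact: measurable_binary_digit.
Qed.

(** Single-digit case of [unif01_digits]. The right-hand side is invariant under negation, which
    yields symmetry, and it has the form of the factors in [unif01_digits], which yields
    independence. *)
Lemma rademacher_term_prob j (B : set (paths R T)) :
  unif01 R (rademacher_term j @^-1` B) =
  ((`[< B (x j) >] + `[< B (- x j) >])%:R / 2)%:E.
Proof.
pose A (b : bool) := `[< B (fun t => (-1) ^+ b * x j t) >].
have := @unif01_digits R (fun=> A) [fset j]%fset.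
rewrite big_seq_fset1 (_ : \bigcap_(i in _) _ = rademacher_term j @^-1` B).
  move=> ->; congr (_%:E); rewrite /A expr0 expr1.
  rewrite (_ : (fun t => 1 * x j t) = x j); last by apply/funext => t; rewrite mul1r.
  by rewrite (_ : (fun t => -1 * x j t) = - x j)//; apply/funext => t; rewrite mulN1r.
apply/seteqP; split=> w /=.
  by move=> /(_ j (fset11 j)) /asboolP.
by move=> h i /fset1P ->; exact/asboolP.
Qed.

Lemma rademacher_term_independent :
  independent_processes (unif01 R) rademacher_term.
Proof.
move=> J B _.
pose A j (b : bool) := `[< B j (fun t => (-1) ^+ b * x j t) >].
rewrite (_ : \bigcap_(j in _) _ = \bigcap_(j in [set` J]) (binary_digit j @^-1` A j)).
  rewrite unif01_digits; apply: eq_bigr => j _; rewrite rademacher_term_prob.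
  rewrite /A expr0 expr1; congr ((_ + _)%:R / 2)%:E; congr (nat_of_bool `[< B j _ >]).
    by apply/funext => t; rewrite mul1r.
  by apply/funext => t; rewrite mulN1r.
by apply/seteqP; split=> w /= h j jJ; apply/asboolP; exact: h.
Qed.

Lemma rademacher_term_symmetric j :
  symmetric_process (unif01 R) (rademacher_term j).
Proof.
move=> B _; pose B' : set (paths R T) := fun f : T -> R => B (- f).
transitivity (unif01 R (rademacher_term j @^-1` B')) => //.
by rewrite !rademacher_term_prob /B' opprK addnC.
Qed.

Let S := partial_sum rademacher_term.

Lemma rademacher_sumE n w t :
  S n w t = \sum_(j < n) (-1) ^+ binary_digit j w * x j t.
Proof. by rewrite /S /partial_sum fct_sumE. Qed.

(* The first [n] digits take finitely many values, so no regularity of [h] is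
   needed. *)
Lemma measurable_digits (h : (nat -> bool) -> R) n :
  measurable_fun [set: measurableTypeR R]
    (fun w => h (fun j => (j < n)%N && binary_digit j w)).
Proof.
elim: n h => [|n IH] h; first exact: (measurable_cst (h (fun=> false))).
pose h' b (e : nat -> bool) := h (fun j => if j == n then b else e j).
rewrite (_ : (fun w => _) = (fun w => if binary_digit n w
  then h' true (fun j => (j < n)%N && binary_digit j w)
  else h' false (fun j => (j < n)%N && binary_digit j w))).
  by apply: measurable_fun_ifT; [exact: measurable_binary_digit|exact: IH|exact: IH].
apply/funext => w; rewrite -(fun_if (fun b => h' b _)).
have -> : (if binary_digit n w then true else false) = binary_digit n w by case: ifP.
congr h; apply/funext => j; rewrite ltnS leq_eqVlt.
by case: eqVneq => [->|].
Qed.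

Lemma measurable_rademacher_sum (g : (T -> R) -> R) n :
  measurable_fun [set: measurableTypeR R] (fun w => g (S n w)).
Proof.
pose h (e : nat -> bool) := g (fun t => \sum_(j < n) (-1) ^+ e j * x j t).
rewrite (_ : (fun w => _) =
  (fun w => h (fun j => (j < n)%N && binary_digit j w))).
  exact: measurable_digits.
apply/funext => w; congr g; apply/funext => t.
by rewrite rademacher_sumE; apply: eq_bigr => j _; rewrite ltn_ord.
Qed.

Hypothesis x_summable :
  forall t, exists M, forall n, \sum_(j < n) `|x j t| <= M.

Definition rademacher_limit (w : measurableTypeR R) (t : T) : R :=
  limn (fun n => S n w t).

(** Absolute convergence is insensitive to signs, so the limit exists for every outcome, not merely
    almost surely. *)
Lemma rademacher_limit_cvg w t : S n w t @[n --> \oo] --> rademacher_limit w t.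
Proof.
suff : cvgn (fun n => S n w t) by [].
pose u j := (-1) ^+ binary_digit j w * x j t.
rewrite (_ : (fun n => S n w t) = series u); last first.
  by apply/funext => n; rewrite rademacher_sumE /series /= big_mkord.
apply: normed_cvg; apply: nondecreasing_is_cvgn.
  apply/nondecreasing_seqP => n /=.
  by rewrite /series /= big_nat_recr//= lerDl.
have [M xM] := x_summable t; exists M => _ [n _ <-].
rewrite /= /series /= big_mkord (le_trans _ (xM n))// ler_sum// => j _.
by rewrite /u normrM normrX normrN1 expr1n mul1r.
Qed.

Lemma measurable_rademacher_limit :
  measurable_fun setT (rademacher_limit : measurableTypeR R -> paths R T).
Proof.
apply: (@measurability _ _ _ (paths R T) _ _ (@coordinate_cylinders R T)) => //.
move=> _ [_ [t _ [Z mZ <-]] <-]; rewrite setTI -comp_preimage.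
rewrite -[X in measurable X]setTI.
have : measurable_fun [set: measurableTypeR R] (fun w => rademacher_limit w t).
  apply: (measurable_fun_cvg (h := fun n w => S n w t)).
    by move=> n; exact: (measurable_rademacher_sum (fun f => f t)).
  by move=> w _; exact: rademacher_limit_cvg.
by move=> /(_ measurableT Z mZ); rewrite setTI.
Qed.

Lemma rademacher_cvg_fdd :
  cvg_fdd (unif01 R) (unif01 R) (partial_sum rademacher_term) rademacher_limit.
Proof.
move=> k t g cg [M [_ gM]]; rewrite unlock.
(* [bounded_fun] only provides bounds strictly above [M], hence [M + 1]. *)
apply: (@dominated_cvg _ _ _ (unif01 R) setT measurableT _ _ (EFin \o cst (M + 1))).
- move=> n; apply/measurable_EFinP.
  exact: (measurable_rademacher_sum (fun f => g (\row_i f (t i)))).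
- move=> w _; apply/fine_cvgP; split; first exact: nearW.
  apply: (@cvg_comp _ _ _ (fun n => \row_i S n w (t i)) g _ _ _ _ (cg _)).
  apply/cvg_ballP => e e0.
  have : \forall n \near \oo, forall i, ball (rademacher_limit w (t i)) e (S n w (t i)).
    apply: filter_forall => i.
    by have /cvg_ballP := @rademacher_limit_cvg w (t i); exact.
  apply: filterS => n h; split=> // i j; rewrite !mxE; exact: h.
- by [].
- exact: finite_measure_integrable_cst.
- by move=> n w _; rewrite /= lee_fin; apply: gM => //; rewrite ltrDl.
Qed.

(** Coefficients in [[-1, 1]] rather than signs: with all but one of them zero, this also places the
    single terms in [F]. *)
Hypothesis carrier_signed_sum : forall (e : nat -> R) (f : T -> R),
  (forall j, `|e j| <= 1) ->
  (forall t, \sum_(j < n) e j * x j t @[n --> \oo] --> f t) -> carrier F f.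

(** Plays the part of a lower bound [2 c] on the norm of [x n] combined with the triangle
    inequality, which the record [function_space] does not include. *)
Hypothesis norm_gap : exists2 c : R, 0 < c & forall n (u v : T -> R),
  (forall t, u t = v t + x n t) -> (c%:E <= fnorm F u)%E \/ (c%:E <= fnorm F v)%E.

(** Condition (i) holds, so validity would give an outcome along which [S n - f] tends to 0 in norm;
    two consecutive terms of it differ by [x n] up to sign, against [norm_gap]. *)
Lemma not_ito_nisio_rademacher : ~ ito_nisio_valid F.
Proof.
move=> IN.
have sign1 b : `|(-1) ^+ b : R| <= 1 by rewrite normrX normrN1 expr1n.
have XF j : process_in F (rademacher_term j).
  split; last exact: measurable_rademacher_term.
  move=> w; pose e i := if i == j then (-1) ^+ binary_digit j w : R else 0.
  apply: (carrier_signed_sum (e := e)).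
    by move=> i; rewrite /e; case: eqP => // _; rewrite normr0.
  move=> t; apply: cvg_near_cst; near=> n.
  have jn : (j < n)%N by near: n; exact: nbhs_infty_gt.
  rewrite (bigD1 (Ordinal jn)) //= /e eqxx big1 ?addr0// => i.
  by rewrite -val_eqE /= => /negbTE ->; rewrite mul0r.
have YF : process_in F rademacher_limit.
  split; last exact: measurable_rademacher_limit.
  move=> w; apply: (carrier_signed_sum (e := fun j => (-1) ^+ binary_digit j w)) => // t.
  under eq_fun do rewrite -rademacher_sumE.
  exact: rademacher_limit_cvg.
have CA : cvg_as (unif01 R) F S.
  apply: (IN _ _ (unif01 R) rademacher_term XF rademacher_term_independent
    rademacher_term_symmetric).1.
  by exists _, _, (unif01 R), rademacher_limit; split=> //; exact: rademacher_cvg_fdd.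
(* The total mass is positive, so an almost sure event contains some outcome. *)
have pf : ProperFilter (almost_everywhere (unif01 R)).
  have P0 : (0 < unif01 R [set: measurableTypeR R])%E.
    by rewrite probability_setT lte01.
  exact: ae_properfilter_algebraOfSetsType P0.
have [w [f _ Sf]] := filter_ex CA.
have [c c0 gap] := norm_gap.
have [N _ SfN] : \forall n \near \oo, (fnorm F (S n w - f)%R < c%:E)%E.
  by apply: (Sf [set y | (y < c%:E)%E]); exact: (@nbhs_open_ereal_lt _ _ (cst c)).
have SN1 t : S N.+1 w t = S N w t + (-1) ^+ binary_digit N w * x N t.
  by rewrite !rademacher_sumE big_ord_recr.
have lN := SfN N (leqnn N); have lN1 := SfN N.+1 (leqnSn N).
(* The sign decides which of the two partial sums takes the role of [u] in the gap. *)
case: (boolP (binary_digit N w)) => b; rewrite ?(negbTE b) ?b in SN1.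
- have [] := gap N (S N w - f) (S N.+1 w - f).
  + by move=> t; rewrite !fctE SN1 expr1 mulN1r; ring.
  + by rewrite leNgt lN.
  + by rewrite leNgt lN1.
- have [] := gap N (S N.+1 w - f) (S N w - f).
  + by move=> t; rewrite !fctE SN1 expr0 mul1r; ring.
  + by rewrite leNgt lN1.
  + by rewrite leNgt lN.
Unshelve. all: by end_near. Qed.

End rademacher_series.

(** * The three counterexamples *)

Section signed_series.
Context (R : realType).

Lemma signed_series_le (e y : nat -> R) (M l : R) :
  (forall j, `|e j| <= 1) -> (forall n, \sum_(j < n) `|y j| <= M) ->
  \sum_(j < n) e j * y j @[n --> \oo] --> l -> `|l| <= M.
Proof.
move=> e1 yM yl.
have nl : `|\sum_(j < n) e j * y j| @[n --> \oo] --> `|l| by exact: cvg_norm.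
apply: (cvgr_to_le nl); apply: nearW => n; apply: le_trans (yM n).
apply: (le_trans (ler_norm_sum _ _ _)); apply: ler_sum => j _.
by rewrite normrM ler_piMl.
Qed.

Lemma sum_at_most_one (a : pred nat) n :
  (forall i j, a i -> a j -> i = j) -> (\sum_(j < n) a j <= 1)%N.
Proof.
move=> a1; rewrite (eq_bigr (fun j : 'I_n => if a j then 1 else 0)%N); last first.
  by move=> j _; case: (a j).
rewrite -big_mkcond /= sum1_card; apply/card_le1_eqP => i j ai aj.
exact/val_inj/a1.
Qed.

(** Source of [norm_gap] in all three spaces: applied to a coordinate or to increments of [u] and
    [v], whose difference comes from [x n]. *)
Lemma half_gap (a b d : R) : d <= `|a - b| -> d / 2 <= `|a| \/ d / 2 <= `|b|.
Proof.
move=> dab; have := ler_normB a b.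
case: (lerP (d / 2) `|a|) => [|ha] hab; [by left|right].
by rewrite leNgt; apply/negP => hb; lra.
Qed.

Lemma linfty_not_ito_nisio : ~ ito_nisio_valid (linfty R).
Proof.
pose x (j k : nat) : R := (j == k)%:R.
have x1 k n : \sum_(j < n) `|x j k| <= 1.
  rewrite (eq_bigr (fun j : 'I_n => (nat_of_ord j == k)%:R)); last first.
    by move=> j _; rewrite ger0_norm.
  rewrite -natr_sum (ler_nat R _ 1); apply: (@sum_at_most_one (pred1 k)).
  by move=> i j /eqP-> /eqP->.
apply: (@not_ito_nisio_rademacher _ _ _ x).
- by move=> k; exists 1.
- move=> e f e1 ef; exists 1; split=> // M M1 k _.
  exact: le_trans (signed_series_le (y := x^~ k) e1 (x1 k) (ef k)) (ltW M1).
- exists (1 / 2); first by rewrite divr_gt0.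
  move=> n u v uv; have : 1 <= `|u n - v n|.
    by rewrite uv /x eqxx addrC addKr normr1.
  have ub (a : nat -> R) : 1 / 2 <= `|a n| ->
      ((1 / 2)%:E <= fnorm (linfty R) a)%E.
    by move=> h; apply: le_ereal_sup_tmp; exists `|a n|%:E; [exists n|rewrite lee_fin].
  by move=> /half_gap[] h; [left|right]; exact: ub.
Qed.

End signed_series.

(** * Signed series with a Hölder bound on summed absolute increments *)

Section hoelder_series.
Context (R : realType) (x : nat -> unit_interval R -> R) (alpha C : R).
Hypothesis x0 : forall j, x j (I0 R) = 0.
Hypothesis x_hoelder : forall n s t,
  \sum_(j < n) `|x j t - x j s| <= C * `|\val t - \val s| `^ alpha.

Lemma hoelder_series_summable t : exists M, forall n, \sum_(j < n) `|x j t| <= M.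
Proof.
exists (C * `|\val t - \val (I0 R)| `^ alpha) => n.
apply: le_trans (x_hoelder n (I0 R) t); apply: ler_sum => j _.
by rewrite x0 subr0.
Qed.

Section signs.
Context (e : nat -> R) (f : unit_interval R -> R).
Hypothesis e1 : forall j, `|e j| <= 1.
Hypothesis ef : forall t, \sum_(j < n) e j * x j t @[n --> \oo] --> f t.

Lemma hoelder_series_le s t : `|f t - f s| <= C * `|\val t - \val s| `^ alpha.
Proof.
apply: (signed_series_le (y := fun j => x j t - x j s) e1).
  by move=> n; exact: x_hoelder.
rewrite (_ : (fun n => _) =
  (fun n => \sum_(j < n) e j * x j t - \sum_(j < n) e j * x j s)).
  exact: cvgB.
by apply/funext => n; rewrite -sumrB; apply: eq_bigr => j _; rewrite mulrBr.
Qed.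

Lemma hoelder_series0 : f (I0 R) = 0.
Proof.
have := @ef (I0 R); rewrite (_ : (fun n => _) = cst 0).
  by move=> /cvg_lim <- //; exact: lim_cst.
by apply/funext => n; rewrite big1// => j _; rewrite x0 mulr0.
Qed.

End signs.
End hoelder_series.

(** * Hölder functions: right continuity and p-variation *)

Section hoelder_spaces.
Context (R : realType).
Implicit Types s t : unit_interval R.

Lemma unit_intervalP t : 0 <= \val t <= 1.
Proof. by have := set_valP t; rewrite /= in_itv. Qed.

Lemma unit_interval_ex (r : R) : 0 <= r <= 1 -> {t : unit_interval R | \val t = r}.
Proof.
move=> r01; have h : r \in `[0 : R, 1]%classic by rewrite mem_setE in_itv.
by exists (exist _ r h).
Qed.

Lemma hoelder_right_continuous (alpha : R) (f : unit_interval R -> R) :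
  0 < alpha -> hoelder_continuous alpha f -> right_continuous01 f.
Proof.
move=> a0 [C fC] t; apply: cvg_within_filter.
have C0 : 0 < `|C| + 1 by rewrite ltr_wpDl.
apply/cvgrPdist_lt => eps eps0.
(* Solves [(|C| + 1) d^alpha = eps]; the sign of [C] is unknown, and [|C| + 1] is positive. *)
pose d := (eps / (`|C| + 1)) `^ alpha^-1.
have d0 : 0 < d by rewrite powR_gt0// divr_gt0.
have vt : \forall s \near t, `|\val t - \val s| < d.
  have /cvgrPdist_lt := @initial_continuous _ R (\val : `[0 : R, 1]%classic -> R) t.
  exact.
apply: filterS vt => s std; apply: (le_lt_trans (fC s t)).
apply: (@le_lt_trans _ _ ((`|C| + 1) * `|\val t - \val s| `^ alpha)).
  by rewrite ler_wpM2r ?powR_ge0// (le_trans (ler_norm _))// lerDl.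
rewrite mulrC -ltr_pdivlMr//.
rewrite (_ : eps / _ = d `^ alpha); last first.
  by rewrite /d -powRrM mulVf ?lt0r_neq0// powRr1// ltW// divr_gt0.
by rewrite gt0_ltr_powR// nnegrE ltW.
Qed.

(** The exponent [1/p] makes the [p]-th power of each increment at most [C^p] times the length of
    its interval, and these lengths telescope to 1. *)
Lemma hoelder_pvariation_le (p C : R) (f : unit_interval R -> R) :
  0 < p -> 0 <= C ->
  (forall s t, `|f t - f s| <= C * `|\val t - \val s| `^ p^-1) ->
  (pvariation p f <= C%:E)%E.
Proof.
move=> p0 C0 fC; apply: ge_ereal_sup => _ [n [t [[t0 tn tS] ->]]].
rewrite lee_fin -[leRHS](powRr1 C0) -(mulfV (lt0r_neq0 p0)) powRrM.
apply: ge0_ler_powR; rewrite ?nnegrE ?invr_ge0 ?powR_ge0 ?(ltW p0)//.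
  by apply: sumr_ge0 => j _; exact: powR_ge0.
apply: (@le_trans _ _ (\sum_(j < n) C `^ p * (\val (t j.+1) - \val (t j)))).
  apply: ler_sum => j _.
  apply: (le_trans (ge0_ler_powR (ltW p0) _ _ (fC (t j) (t j.+1)))).
  - by rewrite nnegrE.
  - by rewrite nnegrE mulr_ge0// powR_ge0.
  rewrite powRM ?powR_ge0// -powRrM mulVf ?lt0r_neq0// powRr1//.
  by rewrite ger0_norm// subr_ge0 tS.
rewrite -mulr_sumr -(big_mkord xpredT (fun j => \val (t j.+1) - \val (t j))).
by rewrite telescope_sumr// t0 tn /= subr0 mulr1.
Qed.

End hoelder_spaces.

(** * Powers of disjoint tents in the Hölder space *)

Section hoelder_counterexample.
Context (R : realType).

(** After dividing by the larger number [a], the ratios [(a - b) / a] and [b / a] lie in [[0, 1]]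
    and add up to 1; there [z <= z^alpha], so their powers add up to at least 1. *)
Lemma powR_subadd_dist (alpha a b : R) : 0 < alpha <= 1 -> 0 <= a -> 0 <= b ->
  `|a `^ alpha - b `^ alpha| <= `|a - b| `^ alpha.
Proof.
move=> /andP[a0 a1] + +; wlog ba : a b / b <= a.
  move=> H ha hb; case: (leP b a) => [|/ltW] h; first exact: H.
  by rewrite distrC (distrC a); exact: H.
move=> ha hb; rewrite !ger0_norm ?subr_ge0//; last first.
  by apply: ge0_ler_powR; rewrite ?nnegrE// ltW.
have [->|an0] := eqVneq a 0.
  by rewrite powR0 ?lt0r_neq0// sub0r (le_trans _ (powR_ge0 _ _))// oppr_le0 powR_ge0.
have ap : 0 < a by rewrite lt_neqAle eq_sym an0.
have le_powR z : 0 <= z <= 1 -> z <= z `^ alpha.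
  move=> /andP[z0 z1]; have [->|zn0] := eqVneq z 0; first exact: powR_ge0.
  by apply: ger1_powR => //; rewrite z1 lt_neqAle eq_sym zn0 z0.
rewrite lerBlDr.
have scale c : 0 <= c -> c `^ alpha = (c / a) `^ alpha * a `^ alpha.
  by move=> c0; rewrite -powRM ?divr_ge0// divfK.
rewrite (scale (a - b)) ?subr_ge0// (scale b)// -mulrDl ler_peMl ?powR_ge0//.
have := lerD (le_powR ((a - b) / a) _) (le_powR (b / a) _).
rewrite -mulrDl subrK divff//; apply.
  by rewrite divr_ge0 ?subr_ge0//= ler_pdivrMr// mul1r lerBlDr lerDl.
by rewrite divr_ge0//= ler_pdivrMr// mul1r.
Qed.

(** Chosen so that [4 r_0 = 1] and [4 r_(j+1) = 2 r_j]: the intervals [[2 r_j, 4 r_j]] fill []0, 1]]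
    and share only endpoints. *)
Let r (j : nat) : R := 2 ^- j.+2.

Let r_gt0 j : 0 < r j. Proof. by rewrite invr_gt0 exprn_gt0. Qed.

Let r_lt i j : (i < j)%N -> 2 * r j <= r i.
Proof.
move=> ij; rewrite /r exprS invfM mulrA divff// mul1r.
by rewrite lef_pV2 ?posrE ?exprn_gt0// ler_eXn2l// ltr1n.
Qed.

(* The tent over [2 r_j, 4 r_j]; these intervals do not overlap. *)
Definition tent (j : nat) (u : R) : R := Num.max 0 (r j - `|u - 3 * r j|).

Lemma tent_ge0 j u : 0 <= tent j u.
Proof. by rewrite /tent le_max lexx. Qed.

Lemma tent_lipschitz j u v : `|tent j u - tent j v| <= `|u - v|.
Proof.
rewrite /tent.
have := ler_dist_dist (u - 3 * r j) (v - 3 * r j).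
rewrite (_ : u - 3 * r j - (v - 3 * r j) = u - v); last by ring.
move: `|u - 3 * r j| `|v - 3 * r j| `|u - v| => a b c.
by rewrite !ler_norml => /andP[h1 h2]; rewrite /Num.max; do 2 case: ltP => ?; apply/andP; split; lra.
Qed.

Lemma tent_disjoint i j u : tent i u != 0 -> tent j u != 0 -> i = j.
Proof.
have H k : tent k u != 0 -> 2 * r k < u < 4 * r k.
  rewrite /tent /Num.max; case: ltP; last by rewrite eqxx.
  by rewrite subr_gt0 ltr_norml => /andP[h1 h2] _; apply/andP; split; lra.
move=> /H/andP[i1 i2] /H/andP[j1 j2].
by case: (ltngtP i j) => // /r_lt ?; exfalso; lra.
Qed.

Lemma C0_not_ito_nisio (alpha : R) : 0 < alpha <= 1 -> ~ ito_nisio_valid (C0 alpha).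
Proof.
move=> alpha01; have /andP[a0 a1] := alpha01.
pose x j (t : unit_interval R) : R := tent j (\val t) `^ alpha.
have x_dist j s t : `|x j t - x j s| <= `|\val t - \val s| `^ alpha.
  apply: le_trans (powR_subadd_dist _ _ _) _; rewrite ?tent_ge0//.
  by apply: ge0_ler_powR; rewrite ?nnegrE ?(ltW a0)// tent_lipschitz.
have r4 j : 4 * r j <= 1.
  rewrite /r -[j.+2]addn2 exprD invfM (_ : 4 = 2 ^+ 2); last by ring.
  rewrite mulrCA divff ?mulr1 ?expf_neq0//.
  by rewrite invf_le1 ?exprn_gt0// exprn_ege1// ler1n.
have x0 j : x j (I0 R) = 0.
  rewrite /x /tent /= sub0r normrN gtr0_norm ?mulr_gt0//.
  by rewrite (max_idPl _) ?powR0 ?lt0r_neq0//; have := r_gt0 j; lra.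
(* At each of the points [s] and [t] at most one tent is nonzero, so at most two summands survive:
   hence the constant 2. *)
have x_hoelder n s t :
    \sum_(j < n) `|x j t - x j s| <= 2 * `|\val t - \val s| `^ alpha.
  pose a (t' : unit_interval R) j := tent j (\val t') != 0.
  have a1' t' : (\sum_(j < n) (a t' j)%:R : R) <= 1.
    rewrite -natr_sum (ler_nat R _ 1); apply: sum_at_most_one.
    by move=> i j; exact: tent_disjoint.
  apply: (@le_trans _ _ (\sum_(j < n) ((a t j)%:R + (a s j)%:R) *
      `|\val t - \val s| `^ alpha)).
    apply: ler_sum => j _; rewrite /a; case: (eqVneq (tent j (\val t)) 0) => tj /=;
      case: (eqVneq (tent j (\val s)) 0) => sj /=.
    - by rewrite /x tj sj subrr normr0 addr0 mul0r.
    - by rewrite add0r mul1r.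
    - by rewrite addr0 mul1r.
    - by rewrite (le_trans (x_dist j s t))// ler_peMl ?powR_ge0// (ler_nat R 1 2).
  by rewrite -mulr_suml ler_wpM2r ?powR_ge0// big_split (lerD (a1' t) (a1' s)).
apply: (@not_ito_nisio_rademacher _ _ _ x).
- exact: (hoelder_series_summable x0 x_hoelder).
- move=> e f e1 ef; split.
    by exists 2 => s t; exact: (hoelder_series_le x_hoelder e1 ef).
  exact: (hoelder_series0 x0 ef).
- exists (1 / 2); first by rewrite divr_gt0.
  move=> n u v uv; have rn := r_gt0 n; have rn4 := r4 n.
  (* [s] is the left foot of the tent and [t] its apex; between them the Hölder quotient of [x n] is
     exactly 1, for every [n]. *)
  have [s sE] : {s : unit_interval R | \val s = 2 * r n}.
    by apply: unit_interval_ex; apply/andP; split; lra.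
  have [t tE] : {t : unit_interval R | \val t = 3 * r n}.
    by apply: unit_interval_ex; apply/andP; split; lra.
  have st : s <> t by move=> E; move: sE; rewrite E tE; lra.
  have dst : `|\val t - \val s| = r n.
    by rewrite sE tE -mulrBl gtr0_norm; lra.
  have xt : x n t = r n `^ alpha.
    by rewrite /x /tent tE subrr normr0 subr0 (max_idPr _)// ltW.
  have xs : x n s = 0.
    rewrite /x /tent sE -mulrBl ltr0_norm; last by lra.
    by rewrite (max_idPl _) ?powR0 ?lt0r_neq0//; lra.
  have : r n `^ alpha <= `|(u t - u s) - (v t - v s)|.
    rewrite !uv xt xs (_ : _ - _ = r n `^ alpha) ?ler_norm//; ring.
  have ub (w : unit_interval R -> R) : r n `^ alpha / 2 <= `|w t - w s| ->
      ((1 / 2)%:E <= fnorm (C0 alpha) w)%E.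
    move=> h; apply: le_ereal_sup_tmp.
    exists (`|w t - w s| / `|\val t - \val s| `^ alpha)%:E; first by exists s, t.
    by rewrite lee_fin dst ler_pdivlMr ?powR_gt0// mulrC mulrA mulr1.
  by move=> /half_gap[] h; [left|right]; exact: ub.
Qed.

End hoelder_counterexample.

(** * Lacunary series of sawtooth waves and bounded p-variation *)

Section pvariation_counterexample.
Context (R : realType).

(** The distance from [u] to the nearest integer, the wave in the Takagi function. *)
Definition dist_int (u : R) : R :=
  Num.min (u - (Num.floor u)%:~R) ((Num.floor u)%:~R + 1 - u).

Lemma dist_int_le u (k : int) : dist_int u <= `|u - k%:~R|.
Proof.
rewrite /dist_int ge_min; apply/orP; case: (leP k (Num.floor u)) => k_u.
  left; apply: le_trans (ler_norm _); rewrite lerB//.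
  by rewrite ler_int.
right; rewrite distrC; apply: le_trans (ler_norm _); rewrite lerB//.
by rewrite -[1](mulr1z 1) -intrD ler_int lezD1.
Qed.

(** With [dist_int_le], this presents [dist_int] as a minimum over the integers; the later facts
    about it rest on these two. *)
Lemma dist_int_ex u : exists k : int, dist_int u = `|u - k%:~R|.
Proof.
have /andP[u1 u2] := floor_itv u; rewrite intrD in u2.
rewrite /dist_int /Num.min; case: ifP => _.
  by exists (Num.floor u); rewrite ger0_norm// subr_ge0.
exists (Num.floor u + 1); rewrite intrD distrC ger0_norm// subr_ge0 ltW//.
Qed.

Lemma dist_int_ge0 u : 0 <= dist_int u.
Proof. by have [k ->] := dist_int_ex u. Qed.

Lemma dist_int_le1 u : dist_int u <= 1.
Proof.
have /andP[u1 u2] := floor_itv u; rewrite intrD in u2.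
by apply: le_trans (dist_int_le u (Num.floor u)) _; rewrite ger0_norm; lra.
Qed.

Lemma dist_int_lipschitz u v : `|dist_int u - dist_int v| <= `|u - v|.
Proof.
have H a b : dist_int a - dist_int b <= `|a - b|.
  have [k ->] := dist_int_ex b; rewrite lerBlDr.
  exact: le_trans (dist_int_le a k) (ler_distD b _ _).
by rewrite ler_norml H andbT lerNl opprB (distrC u) H.
Qed.

Lemma dist_int_nat (k : nat) : dist_int k%:R = 0.
Proof.
apply/eqP; rewrite eq_le dist_int_ge0 andbT.
by apply: le_trans (dist_int_le _ k%:Z) _; rewrite pmulrn subrr normr0.
Qed.

Lemma dist_int_half (k : nat) : dist_int (k%:R / 2) = (odd k)%:R / 2.
Proof.
rewrite -{1}(odd_double_half k) natrD mulrDl -muln2 natrM mulfK//.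
case: (odd k) => /=; last by rewrite !mul0r add0r dist_int_nat.
apply/eqP; rewrite eq_le; apply/andP; split.
  apply: le_trans (dist_int_le _ k./2%:Z) _.
  by rewrite -pmulrn addrK ger0_norm// mul1r invr_ge0.
have [m ->] := dist_int_ex (1 / 2 + k./2%:R).
case: (lerP m k./2%:Z) => h.
  have : m%:~R <= k./2%:R :> R by rewrite pmulrn ler_int.
  by move=> ?; apply: le_trans (ler_norm _); lra.
have : k./2.+1%:R <= m%:~R :> R by rewrite pmulrn ler_int -addn1 PoszD lezD1.
by rewrite -natr1 => ?; rewrite -normrN; apply: le_trans (ler_norm _); lra.
Qed.

Lemma dist_int_half_step (k : nat) :
  `|dist_int (k.+1%:R / 2) - dist_int (k%:R / 2)| = 1 / 2.
Proof.
rewrite !dist_int_half /=; case: (odd k) => /=.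
  by rewrite mul0r sub0r normrN ger0_norm.
by rewrite mul0r subr0 ger0_norm.
Qed.

(** The summand bounds the increment of the [j]-th wave over a distance [d]. It grows like [(2a)^j]
    until [2^j d] reaches 1, then decays like [a^j], with both regimes of order [d^beta]. The proof
    uses the self-similarity [GS] instead of splitting the sum there. *)
Lemma lacunary_sum_le (beta : R) : 0 < beta < 1 ->
  exists2 C : R, 0 <= C & forall n d, 0 <= d <= 1 ->
    \sum_(j < n) (2 `^ - beta) ^+ j * Num.min (2 ^+ j * d) 1 <= C * d `^ beta.
Proof.
move=> /andP[b0 b1]; set a := 2 `^ - beta.
have a0 : 0 < a by exact: powR_gt0.
have gt1_powR2 (c : R) : 0 < c -> 1 < 2 `^ c.
  move=> c0; have := @gt0_ltr_powR R c c0 1 2.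
  by rewrite powR1 !nnegrE ler01 ler0n ltr1n; apply.
have a1 : a < 1 by rewrite /a powRN invf_lt1 ?powR_gt0// gt1_powR2.
have a2 : 1 < 2 * a.
  rewrite /a -{1}[2](@powRr1 R)// -powRD ?pnatr_eq0 ?implybT//.
  by rewrite gt1_powR2// subr_gt0.
pose G n d := \sum_(j < n) a ^+ j * Num.min (2 ^+ j * d) 1.
have GS n d : G n.+1 d = Num.min d 1 + a * G n (2 * d).
  rewrite /G big_ord_recl /= !expr0 !mul1r mulr_sumr; congr (_ + _).
  by apply: eq_bigr => j _; rewrite /bump /= add1n !exprS -!mulrA (mulrCA (2 ^+ j)).
(* [K] is the sum of the geometric series and bounds [G] everywhere; [C'] solves
   [1 - 2 a C' = - C']. The later choice [C = (K + C') / a] covers [d > 1/2], where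
   [d^beta >= a]. *)
pose K := (1 - a)^-1; pose C' := (2 * a - 1)^-1.
have K0 : 0 < K by rewrite invr_gt0 subr_gt0.
have C'0 : 0 < C' by rewrite invr_gt0 subr_gt0.
have KE : 1 + a * K = K by rewrite /K; field; lra.
have C'E : 1 - 2 * a * C' = - C' by rewrite /C'; field; lra.
pose C := (K + C') / a.
have GK n d : G n d <= K.
  elim: n d => [|n IH] d; first by rewrite /G big_ord0 ltW.
  rewrite GS -KE lerD ?ler_pM2l//; first by rewrite ge_min lexx orbT.
have d2 d : 0 <= d -> a * (2 * d) `^ beta = d `^ beta.
  move=> d0; rewrite powRM// mulrA /a -powRD ?pnatr_eq0 ?implybT//.
  by rewrite addNr powRr0 mul1r.
(* Splitting off the first term rescales [d] to [2 d]; the correction [- C' d]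
   absorbs that term since [2 a > 1]. *)
have GC n d : 0 <= d <= 1 -> G n d <= C * d `^ beta - C' * d.
  elim: n d => [|n IH] d /andP[d0 d1].
    rewrite /G big_ord0 subr_ge0.
    have dd : d <= d `^ beta.
      have [->|dn0] := eqVneq d 0; first exact: powR_ge0.
      by apply: ger1_powR; [rewrite d1 andbT lt_neqAle eq_sym dn0|exact: ltW].
    apply: ler_pM => //; first exact: ltW.
    rewrite /C ler_pdivlMr//; apply: (@le_trans _ _ C'); last by rewrite lerDr ltW.
    by rewrite ler_piMr// ltW.
  rewrite GS; case: (leP d (1 / 2)) => dh.
    have d2_01 : 0 <= 2 * d <= 1 by apply/andP; split; lra.
    have h := IH _ d2_01.
    have {}h : a * G n (2 * d) <= C * d `^ beta - 2 * a * C' * d.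
      apply: (le_trans (ler_wpM2l (ltW a0) h)).
      by rewrite -(d2 d)// le_eqVlt; apply/orP; left; apply/eqP; ring.
    have m1 : Num.min d 1 <= d by rewrite ge_min lexx.
    have e : d - 2 * a * C' * d = - C' * d by rewrite -C'E; ring.
    by lra.
  rewrite -GS; apply: (le_trans (GK _ _)).
  have ad : a <= d `^ beta.
    rewrite /a powRN -powR_inv1 ?powR_ge0// -powRrM mulrN1 powRN.
    rewrite -[leLHS]mul1r ler_pdivrMr ?powR_gt0// -powRM//.
    rewrite -[leLHS](powRr0 (d * 2)); apply: ler_powR; last exact: ltW.
    by lra.
  have cd : K + C' <= C * d `^ beta.
    by rewrite /C mulrAC ler_pdivlMr// ler_pM2l// addr_gt0.
  have : C' * d <= C' by rewrite ler_piMr// ltW.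
  by lra.
exists C; first by rewrite divr_ge0 ?addr_ge0// ltW.
move=> n d d01; apply: (le_trans (GC n d d01)).
by rewrite gerBl mulr_ge0 ?(ltW C'0)//; case/andP: d01.
Qed.

Lemma BV_not_ito_nisio (p : R) : 1 < p -> ~ ito_nisio_valid (BV p).
Proof.
move=> p1; have p0 : 0 < p by exact: lt_trans p1.
have b01 : 0 < p^-1 < 1 by rewrite invr_gt0 p0 invf_lt1.
have [C C0 xC] := lacunary_sum_le b01.
set a := 2 `^ - p^-1 in xC.
have a0 : 0 < a by exact: powR_gt0.
(* This decay exactly offsets the number [2^(n+1)] of grid increments, so the [p]-variation of [x n]
   does not shrink. *)
have a_p n : (a ^+ n) `^ p = 2 ^- n.
  rewrite -powR_mulrn ?(ltW a0)// -powRrM mulrC powRrM /a -[X in X `^ _]powRrM.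
  by rewrite mulNr mulVf ?lt0r_neq0// powR_inv1// powR_mulrn ?invr_ge0// exprVn.
pose x n (t : unit_interval R) : R := a ^+ n * dist_int (2 ^+ n * \val t).
have x0 j : x j (I0 R) = 0 by rewrite /x /= mulr0 (dist_int_nat 0) mulr0.
have x_hoelder n s t :
    \sum_(j < n) `|x j t - x j s| <= C * `|\val t - \val s| `^ p^-1.
  have ts : 0 <= `|\val t - \val s| <= 1.
    have /andP[? ?] := unit_intervalP t; have /andP[? ?] := unit_intervalP s.
    by rewrite normr_ge0 ler_norml; lra.
  apply: le_trans (xC n _ ts); apply: ler_sum => j _.
  rewrite /x -mulrBr normrM gtr0_norm ?exprn_gt0// ler_pM2l ?exprn_gt0//.
  rewrite le_min; apply/andP; split.
    apply: (le_trans (dist_int_lipschitz _ _)).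
    by rewrite -mulrBr normrM gtr0_norm// exprn_gt0.
  have h1 := dist_int_le1 (2 ^+ j * \val t); have h2 := dist_int_le1 (2 ^+ j * \val s).
  have h3 := dist_int_ge0 (2 ^+ j * \val t); have h4 := dist_int_ge0 (2 ^+ j * \val s).
  by rewrite ler_norml; lra.
apply: (@not_ito_nisio_rademacher _ _ _ x).
- exact: (hoelder_series_summable x0 x_hoelder).
- move=> e f e1 ef.
  have fC s t := hoelder_series_le x_hoelder e1 ef s t.
  split.
  + by apply: (@hoelder_right_continuous _ p^-1); [rewrite invr_gt0|exists C].
  + by apply: le_lt_trans (hoelder_pvariation_le p0 C0 fC) _; rewrite ltry.
  + exact: (hoelder_series0 x0 ef).
- exists (1 / 4); first by rewrite divr_gt0.
  (* Multiplication by [2^n] sends the grid of mesh [1/N] to the half-integers, where [dist_int]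
     alternates between 0 and 1/2. *)
  move=> n u v uv; pose N := (2 ^ n.+1)%N.
  have NE : N%:R = 2 * 2 ^+ n :> R by rewrite /N natrX exprS.
  have N0 : 0 < N%:R :> R by rewrite NE mulr_gt0// exprn_gt0.
  (* A [subdivision] is indexed by all of [nat]; capping at 1 keeps the points past [N] in the
     interval. *)
  have grid k : {t : unit_interval R | \val t = Num.min (k%:R / N%:R) 1}.
    apply: unit_interval_ex; apply/andP; split; last by rewrite ge_min lexx orbT.
    by rewrite le_min ler01 divr_ge0// ltW.
  pose t k := projT1 (grid k).
  have tE k : (k <= N)%N -> \val (t k) = k%:R / N%:R.
    by move=> kN; rewrite (projT2 (grid k)) (min_idPl _)// ler_pdivrMr// mul1r ler_nat.
  have sub_t : subdivision N t.
    split.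
    + by apply/val_inj; rewrite tE// mul0r.
    + by apply/val_inj; rewrite tE// divff// lt0r_neq0.
    + by move=> j jN; rewrite !tE ?(ltnW jN)// ler_pM2r ?invr_gt0// ler_nat.
  have xt k : (k < N)%N -> `|x n (t k.+1) - x n (t k)| = a ^+ n / 2.
    move=> kN; rewrite /x -mulrBr normrM gtr0_norm ?exprn_gt0// !tE ?(ltnW kN)//.
    have h j : 2 ^+ n * (j%:R / N%:R) = j%:R / 2 :> R.
      by rewrite NE; field; rewrite expf_neq0.
    by rewrite !h dist_int_half_step mul1r.
  pose V (w : unit_interval R -> R) := \sum_(j < N) `|w (t j.+1) - w (t j)| `^ p.
  have V0 w : 0 <= V w by apply: sumr_ge0 => j _; exact: powR_ge0.
  (* Which of [u] and [v] has the large increment may change with [j], so only the sum is bounded at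
     first: [2 * 2^n] terms, each at least [(a^n / 4)^p]. One of [V u], [V v] is then at least
     [(1/4)^p]. *)
  have VS : 2 * (1 / 4) `^ p <= V u + V v.
    rewrite (_ : 2 * _ = \sum_(j < N) (a ^+ n / 2 / 2) `^ p); last first.
      rewrite sumr_const card_ord -[RHS]mulr_natl NE.
      rewrite (_ : a ^+ n / 2 / 2 = a ^+ n * (1 / 4)); last by field.
      rewrite powRM ?exprn_ge0 ?(ltW a0)// ?divr_ge0// a_p.
      by rewrite mulrA -(mulrA 2 (2 ^+ n)) divff ?mulr1 ?expf_neq0.
    rewrite /V -big_split /=; apply: ler_sum => j _.
    have : a ^+ n / 2 <= `|(u (t j.+1) - u (t j)) - (v (t j.+1) - v (t j))|.
      rewrite !uv -(xt j)// le_eqVlt; apply/orP; left; apply/eqP; congr `|_|; ring.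
    have q0 : 0 <= a ^+ n / 2 / 2 by rewrite !divr_ge0// exprn_ge0// ltW.
    move=> /half_gap[] h; [apply: ler_wpDr|apply: ler_wpDl]; rewrite ?powR_ge0//;
      by apply: ge0_ler_powR; rewrite ?nnegrE// ltW.
  have ub w : (1 / 4) `^ p <= V w -> ((1 / 4)%:E <= fnorm (BV p) w)%E.
    move=> h; apply: le_ereal_sup_tmp.
    exists ((V w) `^ p^-1)%:E; first by exists N, t.
    rewrite lee_fin -[leLHS]powRr1// -[X in _ `^ X <= _](mulfV (lt0r_neq0 p0)).
    by rewrite powRrM; apply: ge0_ler_powR; rewrite ?nnegrE ?powR_ge0 ?invr_ge0 ?V0 ?(ltW p0).
  case: (leP ((1 / 4) `^ p) (V u)) => hu; first by left; exact: ub.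
  by right; apply: ub; lra.
Qed.

End pvariation_counterexample.

Theorem mainTheorem8 (R : realType) :
  [/\ ~ ito_nisio_valid (linfty R),
      (forall p : R, 1 < p -> ~ ito_nisio_valid (BV p)) &
      (forall alpha : R, 0 < alpha <= 1 -> ~ ito_nisio_valid (C0 alpha))].
Proof.
split; first exact: linfty_not_ito_nisio.
- exact: BV_not_ito_nisio.
- exact: C0_not_ito_nisio.
Qed.
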